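(* Let $K\ge 2$. Fix constants $\mu_1,\ldots,\mu_M\ge 0$ and $P_1^{\rm ST},\ldots,P_K^{\rm ST}>0$. For a channel realization $\boldsymbol{\alpha}$ consider the problem $$\max_{p_1,\ldots,p_K}\ \log\Big(1+\sum_{k=1}^K h_kp_k\Big)-\sum_{m=1}^M\mu_m\sum_{k=1}^K g_{km}p_k\quad\text{s.t.}\quad 0\le p_k\le P_k^{\rm ST}\ \ \forall k.$$ Let $\pi$ be a permutation of $\{1,\ldots,K\}$ with $\frac{h_{\pi(1)}}{\sum_m\mu_m g_{\pi(1)m}}\ge\frac{h_{\pi(2)}}{\sum_m\mu_m g_{\pi(2)m}}\ge\cdots\ge\frac{h_{\pi(K)}}{\sum_m\mu_m g_{\pi(K)m}}$. Then, for almost every realization $\boldsymbol{\alpha}$, the optimal solution has at most one user with positive power (D-TDMA is optimal) if and only if $$1+h_{\pi(1)}P_{\pi(1)}^{\rm ST}\ \ge\ \frac{h_{\pi(2)}}{\sum_{m=1}^M\mu_m g_{\pi(2)m}} .$$ In that case user $\pi(1)$ is the one selected for transmission, with optimal power $$p_{\pi(1)}^*=\min\Big(P_{\pi(1)}^{\rm ST},\ \Big(\frac{1}{\sum_{m=1}^M\mu_m g_{\pi(1)m}}-\frac{1}{h_{\pi(1)}}\Big)^+\Big),$$ and all other users have zero power.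
   Context: $\boldsymbol{\alpha}=(h_1,\ldots,h_K,g_{11},\ldots,g_{KM})$ is a random vector of nonnegative channel power gains ($h_k$: secondary user $k$ to secondary base station; $g_{km}$: secondary user $k$ to primary receiver $m$) with a continuous, differentiable joint cumulative distribution function, the $h_k$'s and $g_{km}$'s being independent. This per-fading-state problem arises (with $\mu_m$ the multipliers of long-term interference-power constraints) in maximizing the ergodic sum rate of the fading cognitive multiple-access channel under short-term transmit-power and long-term interference-power constraints. Conventions: $1/0=+\infty$, $x/0=+\infty$ for $x>0$, $(x)^+=\max(0,x)$. *)

(* Defs.v *)
From HB Require Import structures.
From mathcomp Require Import all_boot all_order all_algebra fingroup perm.
From mathcomp Require Import all_classical all_reals all_analysis.
Set Implicit Arguments. Unset Strict Implicit. Unset Printing Implicit Defensive.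
Import Order.TTheory GRing.Theory Num.Theory.
Import numFieldNormedType.Exports.
Local Open Scope classical_set_scope.
Local Open Scope ring_scope.

Section Defs.
Variable R : realType.

Section Problem.
Variables (K M : nat) (mu : 'I_M -> R) (Pst : 'I_K -> R)
          (h : 'I_K -> R) (g : 'I_K -> 'I_M -> R).

Definition ft_wgain (k : 'I_K) : R := \sum_(m < M) mu m * g k m.

Definition ft_objective (p : 'I_K -> R) : R :=
  ln (1 + \sum_(k < K) h k * p k)
  - \sum_(m < M) mu m * \sum_(k < K) g k m * p k.

Definition ft_feasible (p : 'I_K -> R) : Prop :=
  forall k, 0 <= p k <= Pst k.

Definition ft_optimal (p : 'I_K -> R) : Prop :=
  ft_feasible p /\ forall q, ft_feasible q -> ft_objective q <= ft_objective p.

Definition ft_at_most_one_pos (p : 'I_K -> R) : Prop :=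
  forall k l, 0 < p k -> 0 < p l -> k = l.

Definition ft_ediv (x y : R) : \bar R := if y == 0 then +oo%E else (x / y)%:E.

Definition ft_ratio (k : 'I_K) : \bar R := ft_ediv (h k) (ft_wgain k).

Definition ft_ratio_sorted (pi : {perm 'I_K}) : Prop :=
  forall i j : 'I_K, (i <= j)%N -> (ft_ratio (pi j) <= ft_ratio (pi i))%E.

Definition ft_tdma_power (k : 'I_K) : \bar R :=
  Order.min (Pst k)%:E (Order.max 0%E (ft_ediv 1 (ft_wgain k) - ft_ediv 1 (h k))%E).
End Problem.

Definition ft_ord_1st (K : nat) (hK : (2 <= K)%N) : 'I_K := Ordinal (ltnW hK).
Definition ft_ord_2nd (K : nat) (hK : (2 <= K)%N) : 'I_K := Ordinal hK.

Section Random.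
Variables (d : measure_display) (T : measurableType d) (P : probability T R).
Variables (K M : nat) (h : 'I_K -> T -> R) (g : 'I_K -> 'I_M -> T -> R).

Definition ft_chan_vec (w : T) : 'rV[R]_(K + K * M) :=
  row_mx (\row_(k < K) h k w) (mxvec (\matrix_(k < K, m < M) g k m w)).

Definition ft_joint_cdf (x : 'rV[R]_(K + K * M)) : R :=
  fine (P [set w | forall i, ft_chan_vec w 0 i <= x 0 i]).

Definition ft_coords_independent : Prop :=
  forall B : 'I_(K + K * M) -> set R, (forall i, measurable (B i)) ->
    fine (P [set w | forall i, B i (ft_chan_vec w 0 i)])
    = \prod_(i < K + K * M) fine (P [set w | B i (ft_chan_vec w 0 i)]).
End Random.
End Defs.

(* Main.v *)
(* For a fixed channel with all [h k] positive, moving one coordinate of an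
   optimal [p] and using [ln (1 + x) <= x] gives the KKT conditions:
   [h k <= G k * snr p] when [p k < Pst k], and [G k * snr p <= h k] when
   [0 < p k], where [G k] is the weighted gain and [snr p] is 1 plus the total
   received power. These settle every case as soon as the [G k] are all zero, or
   all positive with pairwise distinct ratios [h k / G k].
   Almost surely one of the two holds. Continuity of the joint CDF makes every
   coordinate atomless, hence almost surely nonzero. A tie forces [h k] to equal a
   function [h l * G k / G l] of the other coordinates, of which [h k] is
   independent, and by Fubini an atomless variable almost surely avoids an
   independent one. *)
Require Import Defs.
From HB Require Import structures.
From mathcomp Require Import all_boot all_order all_algebra fingroup perm.
From mathcomp Require Import all_classical all_reals all_analysis.
From mathcomp Require Import measurable_realfun ring lra.
Set Implicit Arguments. Unset Strict Implicit. Unset Printing Implicit Defensive.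
Import Order.TTheory GRing.Theory Num.Theory.
Import numFieldNormedType.Exports.
Local Open Scope classical_set_scope.
Local Open Scope ring_scope.

(** * The optimization problem for a fixed channel *)

Lemma continuous_ln1DB (R : realType) (U : topologicalType) (f1 f2 : U -> R)
    (v : U) :
  0 < 1 + f1 v -> {for v, continuous f1} -> {for v, continuous f2} ->
  {for v, continuous (fun u => ln (1 + f1 u) - f2 u)}.
Proof.
move=> f1v cf1 cf2; apply: (@cvgB _ _ _ (nbhs v)); last exact: cf2.
have cf1' : {for v, continuous (fun u => 1 + f1 u)}.
  by apply: (@cvgD _ _ _ (nbhs v)); [exact: cvg_cst|exact: cf1].
exact: (continuous_comp cf1' (continuous_ln f1v)).
Qed.

Section Deterministic.
Variables (R : realType) (K M : nat) (mu : 'I_M -> R) (Pst : 'I_K -> R).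
Variables (h : 'I_K -> R) (g : 'I_K -> 'I_M -> R).
Hypothesis Pst_gt0 : forall k, 0 < Pst k.
Hypothesis h_gt0 : forall k, 0 < h k.

Local Notation G := (ft_wgain mu g).
Local Notation feasible := (ft_feasible Pst).
Local Notation optimal := (ft_optimal mu Pst h g).
Local Notation snr p := (1 + \sum_(k < K) h k * p k).

(** Exchanging the two sums collects the interference prices into a single linear price [G k] per
    user. *)
Lemma ft_objectiveE p :
  ft_objective mu h g p = ln (snr p) - \sum_(k < K) G k * p k.
Proof.
rewrite /ft_objective /ft_wgain; congr (_ - _).
under eq_bigr do rewrite mulr_sumr.
rewrite exchange_big /=; apply: eq_bigr => k _.
by rewrite mulr_suml; apply: eq_bigr => m _; rewrite mulrA.
Qed.

Lemma snr_ge1 p : feasible p -> 1 <= snr p.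
Proof.
move=> fp; rewrite lerDl; apply: sumr_ge0 => k _.
by rewrite mulr_ge0 ?(ltW (h_gt0 k))//; case/andP: (fp k).
Qed.

Lemma snr_single p k : (forall j, j != k -> p j = 0) -> snr p = 1 + h k * p k.
Proof.
move=> p0; rewrite (bigD1 k)//= [X in _ + (_ + X)]big1 ?addr0//.
by move=> j /p0 ->; rewrite mulr0.
Qed.

Lemma sum_shift_coord (a p : 'I_K -> R) k t :
  \sum_(j < K) a j * (p j + (j == k)%:R * t) = \sum_(j < K) a j * p j + a k * t.
Proof.
under eq_bigr do rewrite mulrDr.
rewrite big_split /=; congr (_ + _).
rewrite (bigD1 k)//= eqxx mul1r big1 ?addr0// => j /negbTE ->.
by rewrite mul0r mulr0.
Qed.

(** A first-order condition obtained without derivatives. Both sides keep the factor [t], so the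
    inequality serves upward and downward shifts alike. *)
Lemma optimal_shift p k t : optimal p -> 0 <= p k + t <= Pst k ->
  h k * t <= G k * t * (snr p + h k * t).
Proof.
move=> [fp op] pkt; pose q j := p j + (j == k)%:R * t.
have fq : feasible q.
  by move=> j; rewrite /q; case: eqVneq => [->|_]; rewrite ?mul1r// mul0r addr0.
have := op q fq; rewrite !ft_objectiveE !sum_shift_coord addrA.
have D'1 : 1 <= snr p + h k * t.
  by rewrite -addrA -sum_shift_coord; exact: snr_ge1.
have D1 := snr_ge1 fp.
move: (snr p) D1 D'1 => D D1 D'1 le_qp.
have D0 : 0 < D by lra.
have D'0 : 0 < D + h k * t by lra.
(* The argument of [ln (1 + x) <= x] is chosen so that [1 + x] is the ratio of the old SNR to the
   shifted one. *)
have : ln (1 + - (h k * t / (D + h k * t))) <= - (h k * t / (D + h k * t)).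
  apply: le_ln1Dx; rewrite ltrN2 ltr_pdivrMr// mul1r; lra.
have -> : 1 + - (h k * t / (D + h k * t)) = D / (D + h k * t).
  by field; rewrite gt_eqF.
rewrite ln_div ?posrE// => le_ln.
rewrite -ler_pdivrMr//; lra.
Qed.

(** Stands in for the limit [t -> 0+] when the KKT conditions are drawn from small shifts. *)
Lemma le_of_le_small (a b c e : R) : 0 < e -> 0 <= c ->
  (forall t, 0 < t -> t <= e -> a <= b + c * t) -> a <= b.
Proof.
move=> e0 c0 H; apply/ler_addgt0Pr => d d0.
have c10 : 0 < c + 1 by lra.
have t0 : 0 < Order.min e (d / (c + 1)) by rewrite lt_min e0 divr_gt0.
apply: le_trans (H _ t0 _) _; first by rewrite ge_min lexx.
rewrite lerD2l; apply: (@le_trans _ _ (c * (d / (c + 1)))).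
  by rewrite ler_wpM2l// ge_min lexx orbT.
rewrite mulrA ler_pdivrMr//; nra.
Qed.

Hypothesis G_ge0 : forall k, 0 <= G k.

Lemma optimal_kkt_lt p k : optimal p -> p k < Pst k -> h k <= G k * snr p.
Proof.
move=> op pk; have [fp _] := op.
apply: (@le_of_le_small _ _ (G k * h k) (Pst k - p k)); first by rewrite subr_gt0.
  by rewrite mulr_ge0// ltW.
move=> t t0 te; have /andP[pk0 _] := fp k.
have /(optimal_shift op) : 0 <= p k + t <= Pst k by apply/andP; split; lra.
by rewrite mulrAC ler_pM2r// mulrDr mulrA.
Qed.

Lemma optimal_kkt_gt p k : optimal p -> 0 < p k -> G k * snr p <= h k.
Proof.
move=> op pk; have [fp _] := op.
apply: (@le_of_le_small _ _ (G k * h k) (p k)) => //.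
  by rewrite mulr_ge0// ltW.
move=> t t0 te; have /andP[_ pkP] := fp k.
(* The shift is now downward, and dividing by [- t] reverses the inequality. *)
have /(optimal_shift op) : 0 <= p k + - t <= Pst k by apply/andP; split; lra.
rewrite !mulrN mulNr lerN2 mulrAC ler_pM2r// mulrBr mulrA; lra.
Qed.

(** A continuous function on a compact box attains its maximum. Existence keeps a claim about all
    optimal [p] from holding vacuously. *)
Lemma exists_optimal : exists p, optimal p.
Proof.
pose A := [set v : 'rV[R]_K | forall k, `[0, Pst k]%classic (v ord0 k)].
pose obj (v : 'rV[R]_K) := ft_objective mu h g (fun k => v ord0 k).
have feasA v : A v -> feasible (fun k => v ord0 k).
  by move=> Av k; have := Av k; rewrite /= in_itv.
have [||v|v] := @compact_EVT_max _ R obj A.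
- by exists 0 => k /=; rewrite mxE in_itv/= lexx ltW.
- apply: (@rV_compact R K (fun k => `[0, Pst k]%classic)) => k.
  exact: segment_compact.
- move: v; apply: continuous_in_subspaceT => v /set_mem Av.
  have cv (c : 'I_K -> R) :
      {for v, continuous (fun u : 'rV[R]_K => \sum_(k < K) c k * u ord0 k)}.
    apply: (@cvg_big _ _ _ _ _ add_continuous _ (nbhs v)) => k _.
    by apply: cvgMr; exact: coord_continuous.
  rewrite /obj (_ : (fun _ => _) =
    (fun u : 'rV[R]_K => ln (1 + \sum_(k < K) h k * u ord0 k) -
       \sum_(k < K) G k * u ord0 k)); last first.
    by apply/funext => u; rewrite ft_objectiveE.
  apply: continuous_ln1DB; [|exact: cv|exact: cv].
  by apply: lt_le_trans (snr_ge1 (feasA _ Av)).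
- move=> /set_mem Av vmax; exists (fun k => v ord0 k); split; first exact: feasA.
  move=> q fq; have := vmax (\row_k q k).
  rewrite /obj (_ : (fun k => (\row_k q k) ord0 k) = q); last first.
    by apply/funext => k; rewrite mxE.
  by apply; rewrite inE => k /=; rewrite mxE in_itv/=.
Qed.

(** Power is free for such a user: below the cap, KKT would give [h k <= 0]. *)
Lemma pos_of_wgain0 p k : G k = 0 -> optimal p -> 0 < p k.
Proof.
move=> Gk0 op; case: (op) => /(_ k)/andP[_ pkP] _.
have [pk|] := ltP (p k) (Pst k); last exact: lt_le_trans.
by have := optimal_kkt_lt op pk; rewrite Gk0 mul0r leNgt h_gt0.
Qed.


(** * Optimal powers in terms of the two best users *)

Section TwoBestUsers.
Variables a b : 'I_K.
Hypothesis ba : b != a.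
Hypothesis G_gt0 : forall k, 0 < G k.
(** The order of the ratios [h k / G k], cross-multiplied. It is strict for [a] because ties are
    excluded. *)
Hypothesis a_best : forall k, k != a -> h k * G a < h a * G k.
Hypothesis b_second : forall k, k != a -> h k * G b <= h b * G k.

(* A transmitting user [k != a] would force [a] to full power and the total SNR
   [snr p] above [1 + h a * Pst a >= h b / G b >= h k / G k], against KKT. *)
Lemma best_user_only p : h b <= (1 + h a * Pst a) * G b -> optimal p ->
  forall k, k != a -> p k = 0.
Proof.
move=> cond op k ka; have [fp _] := op.
have [pk0 _] := andP (fp k).
apply/eqP; rewrite eq_le pk0 andbT leNgt; apply/negP => pk.
have kkt_k := optimal_kkt_gt op pk.
have paP : p a = Pst a.
  apply/eqP; rewrite eq_le; have /andP[_ ->] /= := fp a.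
  rewrite leNgt; apply/negP => /(optimal_kkt_lt op) kkt_a.
  have := a_best ka; rewrite ltNge => /negP; apply.
  have : h a * G k <= G a * snr p * G k by rewrite ler_pM2r.
  have : G k * snr p * G a <= h k * G a by rewrite ler_pM2r.
  lra.
have : 1 + h a * Pst a + h k * p k <= snr p.
  rewrite (bigD1 a)//= (bigD1 k)//= paP !addrA lerDl; apply: sumr_ge0 => j _.
  by rewrite mulr_ge0 ?(ltW (h_gt0 j))//; case/andP: (fp j).
have hp : 0 < h k * p k by rewrite mulr_gt0.
move=> leD; have ltD : 1 + h a * Pst a < snr p by lra.
have := b_second ka; rewrite leNgt => /negP; apply.
apply: (@le_lt_trans _ _ ((1 + h a * Pst a) * G b * G k)); first by rewrite ler_pM2r.
apply: (@lt_le_trans _ _ (snr p * G b * G k)); first by rewrite !ltr_pM2r.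
by rewrite mulrAC ler_pM2r// mulrC.
Qed.

(** With the other users silent, [snr p] is [1 + h a * p a], and KKT compares [p a] with
    [1 / G a - 1 / h a]. Clipping that level to the interval from 0 to [Pst a] gives the formula. *)
Lemma best_user_power p : h b <= (1 + h a * Pst a) * G b -> optimal p ->
  (p a)%:E = ft_tdma_power mu Pst h g a.
Proof.
move=> cond op; have /andP[pa0 paP] := (proj1 op) a.
have kkt_lt := @optimal_kkt_lt p a op; have kkt_gt := @optimal_kkt_gt p a op.
move: kkt_lt kkt_gt; rewrite (snr_single (best_user_only cond op)).
have Ga := G_gt0 a; have ha := h_gt0 a.
rewrite /ft_tdma_power /ft_ediv !gt_eqF// -EFinB !div1r -!EFin_max -EFin_min.
(* [E] and [E'] translate a comparison of [x] with the unclipped level into the KKT inequality at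
   power [x]. *)
have E (x : R) : (x <= (G a)^-1 - (h a)^-1) = (G a * (1 + h a * x) <= h a).
  rewrite lerBrDr -(ler_pM2l Ga) divff ?gt_eqF// -(ler_pM2l ha) mulr1.
  by congr (_ <= _); field; rewrite gt_eqF.
have E' (x : R) : ((G a)^-1 - (h a)^-1 <= x) = (h a <= G a * (1 + h a * x)).
  rewrite lerBlDr -(ler_pM2l Ga) divff ?gt_eqF// -(ler_pM2l ha) mulr1.
  by congr (_ <= _); field; rewrite gt_eqF.
rewrite -E -E'; set v := _ - _; move=> kl kg; congr EFin.
have Pa := Pst_gt0 a.
have [pl|pge] := ltP (p a) (Pst a).
  have vle := kl pl.
  have [p0|ple] := ltP 0 (p a).
    have vp : v = p a by apply/eqP; rewrite eq_le vle kg.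
    by rewrite vp (max_idPr _) ?(min_idPr _).
  have p0 : p a = 0 by apply/eqP; rewrite eq_le ple.
  by rewrite p0 in vle *; rewrite (max_idPl _) ?(min_idPr _)// ltW.
have pP : p a = Pst a by apply/eqP; rewrite eq_le paP.
rewrite pP in kg *.
by rewrite (min_idPl _)// le_max kg ?orbT.
Qed.

(** If at most one user transmitted, it would be [a]; KKT for the silent [b] would then give
    [h b <= G b * (1 + h a * p a)], contradicting the assumption since [p a <= Pst a]. *)
Lemma two_users_pos p : (1 + h a * Pst a) * G b < h b -> optimal p ->
  ~ ft_at_most_one_pos p.
Proof.
move=> ncond op amo; have [fp _] := op.
have p_ge0 k : 0 <= p k by case/andP: (fp k).
have zero k : ~ 0 < p k -> p k = 0.
  by move=> /negP; rewrite -leNgt => pk; apply/eqP; rewrite eq_le pk p_ge0.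
(* If [a] were silent, the ranking and KKT would silence everyone, so [snr p = 1] and [h a <= G a].
   But the assumption forces [G b < h b], so [b] would outrank [a]. *)
have a_pos : 0 < p a.
  apply/negPn/negP => /negP/zero pa0.
  have kkt_a : h a <= G a * snr p by apply: optimal_kkt_lt => //; rewrite pa0.
  have others0 k : k != a -> p k = 0.
    move=> ka; apply: zero => /(optimal_kkt_gt op) kkt_k.
    have := a_best ka; rewrite ltNge => /negP; apply.
    have : h a * G k <= G a * snr p * G k by rewrite ler_pM2r.
    have : G k * snr p * G a <= h k * G a by rewrite ler_pM2r.
    lra.
  move: kkt_a; rewrite (snr_single others0) pa0 mulr0 addr0 mulr1 => haG.
  have hbG : G b < h b.
    apply: le_lt_trans ncond; rewrite ler_peMl ?(ltW (G_gt0 b))//.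
    by rewrite lerDl ltW// mulr_gt0.
  have := a_best ba; rewrite ltNge => /negP; apply.
  apply: (@le_trans _ _ (G a * G b)); first by rewrite ler_pM2r.
  by rewrite mulrC ler_pM2r// ltW.
have others0 k : k != a -> p k = 0.
  by move=> ka; apply: zero => pk; move: ka; rewrite (amo _ _ pk a_pos) eqxx.
have : h b <= G b * snr p by apply: optimal_kkt_lt => //; rewrite others0.
rewrite (snr_single others0) leNgt => /negP; apply; apply: le_lt_trans ncond.
rewrite mulrC ler_pM2r// lerD2l ler_pM2l//.
by case/andP: (fp a).
Qed.

End TwoBestUsers.

(** When all [G k] vanish, every ratio is [+oo], so the condition fails, and all users transmit.
    Otherwise the ranking is cross-multiplied and the results on the two best users apply. *)
Lemma dtdma_optimality (hK : (2 <= K)%N) (pi : {perm 'I_K}) :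
  let a := pi (ft_ord_1st hK) in let b := pi (ft_ord_2nd hK) in
  (forall k, G k = 0) \/
    (forall k, 0 < G k) /\ (forall k l, k != l -> h k * G l != h l * G k) ->
  ft_ratio_sorted mu h g pi ->
  let cond := (ft_ratio mu h g b <= (1 + h a * Pst a)%:E)%E in
  ((forall p, optimal p -> ft_at_most_one_pos p) <-> cond) /\
  (cond -> forall p, optimal p ->
     (p a)%:E = ft_tdma_power mu Pst h g a /\ (forall k, k != a -> p k = 0)).
Proof.
move=> a b GP sorted cond.
have ba : b != a by rewrite (inj_eq perm_inj).
have [p0 op0] := exists_optimal.
case: GP => [G0|[G_gt0 noties]].
  have ncond : ~ cond by rewrite /cond /ft_ratio /ft_ediv G0 eqxx leye_eq.
  split=> //; split=> // amo.
  have := amo p0 op0 a b (pos_of_wgain0 (G0 a) op0) (pos_of_wgain0 (G0 b) op0).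
  by move=> ab; rewrite ab eqxx in ba.
have ratio_le k l : (ft_ratio mu h g k <= ft_ratio mu h g l)%E =
    (h k * G l <= h l * G k).
  rewrite /ft_ratio /ft_ediv !gt_eqF// lee_fin ler_pdivrMr// mulrAC.
  by rewrite ler_pdivlMr.
have condE : cond <-> h b <= (1 + h a * Pst a) * G b.
  by rewrite /cond /ft_ratio /ft_ediv gt_eqF// lee_fin ler_pdivrMr.
(* Each user has a position in the ranking, and a user other than [a] has position at least 1, which
   is that of [b]. *)
have rank k : exists2 i, (k != a -> (0 < (i : 'I_K))%N) & k = pi i.
  exists (pi^-1 k)%g; last by rewrite permKV.
  move=> ka; rewrite lt0n; apply: contra ka => /eqP i0.
  by rewrite /a -[k in k == _](permKV pi); apply/eqP; congr (pi _); apply: val_inj.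
have a_best k : k != a -> h k * G a < h a * G k.
  move=> ka; rewrite lt_neqAle noties//= -ratio_le.
  by have [i _ ->] := rank k; exact: sorted.
have b_second k : k != a -> h k * G b <= h b * G k.
  move=> ka; rewrite -ratio_le.
  by have [i /(_ ka) i0 ->] := rank k; exact: sorted.
split; last first.
  move=> /condE c p op; split; last first.
    exact: (best_user_only G_gt0 a_best b_second c op).
  exact: (best_user_power G_gt0 a_best b_second c op).
rewrite condE; split=> [amo|c p op].
  rewrite leNgt; apply/negP => nc.
  exact: (two_users_pos ba G_gt0 a_best nc op0 (amo _ op0)).
have p0' := best_user_only G_gt0 a_best b_second c op.
have eqa k : 0 < p k -> k = a.
  by move=> pk; apply/eqP/negPn/negP => /p0' pk0; rewrite pk0 ltxx in pk.
by move=> k l /eqa -> /eqa ->.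
Qed.

End Deterministic.

(** * Independent coordinates with a continuous joint distribution *)

Section Probability.
Context (R : realType) (d : measure_display) (T : measurableType d).
Context (P : probability T R) (n : nat) (X : 'I_n -> T -> R).
Hypothesis mX : forall i, measurable_fun [set: T] (X i).

Let cdf (x : 'rV[R]_n) := fine (P [set w | forall i, X i w <= x 0 i]).

Definition rectangle (D : {pred 'I_n}) (B : 'I_n -> set R) : set T :=
  [set w | forall i, i \in D -> B i (X i w)].

Lemma measurable_rectangle D B :
  (forall i, measurable (B i)) -> measurable (rectangle D B).
Proof.
move=> mB; rewrite (_ : rectangle D B =
  \bigcap_(i in [set` D]) (X i @^-1` B i)); last first.
  by apply/seteqP; split=> w /=; [move=> H i|move=> H i]; exact: H.
apply: fin_bigcap_measurable; first exact: finite_finset.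
by move=> i _; rewrite -[X in measurable X]setTI; exact: mX.
Qed.

(** An atom of [X i] at [c] would make the joint CDF jump along coordinate [i], once the other
    coordinates are bounded by a constant large enough to retain part of its mass. *)
Lemma continuous_cdf_no_atom i c : continuous cdf -> P [set w | X i w = c] = 0%E.
Proof.
move=> ccdf; apply/eqP; rewrite eq_le measure_ge0 andbT leNgt; apply/negP => atom.
pose A (N : nat) := [set w | X i w = c] `&` rectangle (predC1 i)
  (fun=> `]-oo, N%:R]%classic).
have mc : measurable [set w | X i w = c].
  rewrite (_ : [set _ | _] = X i @^-1` [set c]) // -[X in measurable X]setTI.
  exact: mX.
have mA N : measurable (A N).
  apply: measurableI => //; apply: measurable_rectangle => j.
  exact: measurable_itv.
have UA : \bigcup_N A N = [set w | X i w = c].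
  apply/seteqP; split=> [w [N _ []] //|w Xw].
  exists (\max_(j < n) (Num.truncn `|X j w|).+1)%N => //; split=> // j _.
  rewrite /= in_itv/=; apply: le_trans (ler_norm _) _; apply: ltW.
  apply: lt_le_trans (truncnS_gt _) _.
  by rewrite ler_nat (leq_bigmax j).
have ndA : nondecreasing_seq A.
  move=> N N' NN'; apply/subsetPset => w [Xw Hw]; split=> // j ji.
  by have := Hw j ji; rewrite /= !in_itv/= => /le_trans; apply; rewrite ler_nat.
have [N AN0] : exists N, (0 < P (A N))%E.
  apply/not_existsP => A0; move: atom; rewrite ltNge => /negP; apply.
  rewrite -UA; have := @nondecreasing_cvg_mu _ _ _ P A mA _ ndA.
  rewrite UA => /(_ mc) /cvg_lim <- //.
  rewrite (_ : _ \o _ = cst 0%E) ?lim_cst//; apply/funext => N /=.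
  by apply/eqP; rewrite eq_le measure_ge0 andbT leNgt; apply/negP/A0.
(* A line in direction [i], with every other coordinate fixed at the bound [N]. *)
pose x t : 'rV[R]_n := \row_j (if j == i then t else N%:R).
have xE t : x t = x 0 + t *: delta_mx 0 i.
  apply/rowP => j; rewrite !mxE eqxx /=; case: ifP => _; first by rewrite mulr1 add0r.
  by rewrite mulr0 addr0.
have cx : {for c, continuous (cdf \o x)}.
  apply: continuous_comp; last exact: ccdf.
  rewrite (_ : x = fun t => x 0 + t *: delta_mx 0 i); last exact/funext.
  apply: continuousD; first exact: cst_continuous.
  by apply: continuousZl; exact: cvg_id.
have mF t : measurable [set w | forall j, X j w <= x t 0 j].
  rewrite (_ : [set _ | _] = rectangle predT (fun j => `]-oo, x t 0 j]%classic)).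
    by apply: measurable_rectangle => j; exact: measurable_itv.
  by apply/seteqP; split => w /= H j; have := H j; rewrite /= in_itv//=; apply.
(* For [t < c] the event below [x t] is disjoint from [A N], and both lie in the event below
   [x c]. *)
have jump t : t < c -> cdf (x t) + fine (P (A N)) <= cdf (x c).
  move=> tc; rewrite /cdf -fineD ?fin_num_measure// fine_le ?fin_num_measure//.
    by rewrite fin_numD !fin_num_measure.
  rewrite -measureU//; last first.
    apply/seteqP; split=> // w [] /(_ i); rewrite mxE eqxx => Xit [/= Xw _].
    by move: Xit; rewrite Xw leNgt tc.
  apply: le_measure; rewrite ?inE//; first exact: measurableU.
  move=> w [H j|[/= Xw H] j]; rewrite mxE.
    have := H j; rewrite mxE; case: ifP => // _ /le_trans; apply; exact: ltW.
  case: eqVneq => [->|ji]; first by rewrite Xw.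
  by have := H j ji; rewrite /= in_itv.
have a0 : 0 < fine (P (A N)) by rewrite fine_gt0// AN0 ltey_eq fin_num_measure.
move/cvgrPdist_lt: cx => /(_ _ a0).
move=> /nbhs_ballP[e /= e0 H].
have ce : c - e / 2 < c by rewrite ltrBlDr ltrDl divr_gt0.
have := H (c - e / 2); rewrite /ball/= opprB addrC subrK gtr0_norm ?divr_gt0//.
rewrite ltr_pdivrMr// ltr_pMr// ltr1n => /(_ isT).
have := jump _ ce => J; rewrite ger0_norm; lra.
Qed.


(** * Independence of one coordinate from all the others *)

Hypothesis indepX : forall B : 'I_n -> set R, (forall i, measurable (B i)) ->
  fine (P [set w | forall i, B i (X i w)]) =
  \prod_(i < n) fine (P [set w | B i (X i w)]).

(* A pi-system generating the sigma-algebra of the coordinates [X j], [j != i]. *)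
Definition others i : set_system T :=
  [set A | exists2 B, (forall j, measurable (B j)) & A = rectangle (predC1 i) B].

Lemma measurable_others i j : j != i ->
  measurable_fun [set: g_sigma_algebraType (others i)] (X j).
Proof.
move=> ji _ B mB; apply: sub_sigma_algebra.
exists (fun l => if l == j then B else setT).
  by move=> l; case: ifP.
rewrite setTI; apply/seteqP; split=> w /=.
  by move=> Bw l _; case: eqVneq => // ->.
by move/(_ j); rewrite !inE eqxx; apply.
Qed.

Lemma measurable_of_others i (Y : T -> R) :
  measurable_fun [set: g_sigma_algebraType (others i)] Y ->
  measurable_fun [set: T] Y.
Proof.
move=> mY _ B mB; have := mY measurableT B mB.
apply: smallest_sub; first exact: sigma_algebra_measurable.
by move=> _ [C mC ->]; exact: measurable_rectangle.
Qed.

(** The product formula is used twice, with [B0] and then with [setT] in slot [i]; the second use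
    identifies the remaining product as [P A]. *)
Lemma indep_rectangle i (B0 : set R) A : measurable B0 -> others i A ->
  P (A `&` X i @^-1` B0) = (P (X i @^-1` B0) * P A)%E.
Proof.
move=> mB0 [B mB ->].
have mA := measurable_rectangle (predC1 i) mB.
have mi : measurable (X i @^-1` B0).
  by rewrite -[Y in measurable Y]setTI; exact: mX.
rewrite -[LHS]fineK ?fin_num_measure//; last exact: measurableI.
rewrite -[X in (X * _)%E]fineK ?fin_num_measure//.
rewrite -[X in (_ * X)%E]fineK ?fin_num_measure// -EFinM; congr EFin.
have eqP_ C : measurable C -> fine (P (rectangle (predC1 i) B `&` X i @^-1` C)) =
    fine (P (X i @^-1` C)) * \prod_(j < n | j != i) fine (P (X j @^-1` B j)).
  move=> mC.
  transitivity (fine (P [set w | forall j, (if j == i then C else B j) (X j w)])).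
    congr (fine (P _)); apply/seteqP; split => w /=.
      move=> [Bw Cw] j; case: eqVneq => [-> //|ji].
      by apply: Bw; rewrite inE.
    move=> H; split; last by have := H i; rewrite eqxx.
    by move=> j; rewrite inE => ji; have := H j; rewrite (negbTE ji).
  rewrite (@indepX (fun j => if j == i then C else B j)); last by move=> j; case: ifP.
  rewrite (bigD1 i)//= eqxx; congr (_ * _).
  by apply: eq_bigr => j /negbTE ->.
rewrite eqP_//; congr (_ * _).
have := eqP_ setT measurableT.
by rewrite preimage_setT setIT probability_setT mul1r.
Qed.

(** Both sides are finite measures in [A] that agree on a pi-system, hence on the sigma-algebra it
    generates. *)
Lemma indep_others i (B0 : set R) A : measurable B0 -> <<s others i >> A ->
  P (A `&` X i @^-1` B0) = (P (X i @^-1` B0) * P A)%E.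
Proof.
move=> mB0 sA.
have mi : measurable (X i @^-1` B0).
  by rewrite -[Y in measurable Y]setTI; exact: mX.
have PB_ge0 : 0 <= fine (P (X i @^-1` B0)) by exact: fine_ge0.
rewrite -[X in (X * _)%E]fineK ?fin_num_measure//.
have othersT : others i setT.
  by exists (fun=> setT) => //; apply/seteqP; split.
apply: (@g_sigma_algebra_measure_unique _ _ _ (others i) _ (fun=> setT) _ _
  (mrestr P mi) (mscale (NngNum PB_ge0) P) _ _ _ A sA) => //.
- by move=> _ [B mB ->]; exact: measurable_rectangle.
- by apply/seteqP; split=> // w _; exists 0%N.
- move=> _ _ [B mB ->] [C mC ->]; exists (fun j => B j `&` C j).
    by move=> j; exact: measurableI.
  apply/seteqP; split => w /=.
    by move=> [Bw Cw] j ji; split; [exact: Bw|exact: Cw].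
  by move=> H; split=> j /H[].
- move=> A' oA'; change (P (A' `&` X i @^-1` B0) = (fine (P (X i @^-1` B0)))%:E * P A')%E.
  by rewrite fineK ?fin_num_measure//; exact: indep_rectangle.
- move=> _; change (P (setT `&` X i @^-1` B0) < +oo)%E.
  by rewrite setTI ltey_eq fin_num_measure.
Qed.

(** By independence the law of [(Y, X i)] is a product measure, so the claim says that the diagonal
    is null for it. *)
Lemma prob_eq_others i (Y : T -> R) :
  measurable_fun [set: g_sigma_algebraType (others i)] Y ->
  (forall c, P [set w | X i w = c] = 0%E) ->
  P [set w | X i w = Y w] = 0%E.
Proof.
move=> mY noatom.
have mY' := measurable_of_others mY.
pose YX w := (Y w, X i w).
have mYX : measurable_fun [set: T] YX by exact: measurable_fun_pair.
pose XX := (mfun_Sub (mem_set (mX i)) : {mfun T >-> R}).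
pose YY := (mfun_Sub (mem_set mY') : {mfun T >-> R}).
pose ZZ := (mfun_Sub (mem_set mYX) : {mfun T >-> _}).
have rect A B : measurable A -> measurable B ->
    distribution P ZZ (A `*` B) = (distribution P YY A * distribution P XX B)%E.
  move=> mA mB; rewrite /distribution /pushforward /= muleC.
  have -> : YX @^-1` (A `*` B) = Y @^-1` A `&` X i @^-1` B by [].
  rewrite -indep_others//; have := mY measurableT A mA; by rewrite setTI.
pose diag := [set z : R * R | z.2 == z.1].
have mdiag : measurable diag.
  rewrite -[X in measurable X]setTI.
  exact: (measurable_fun_eqr measurable_snd measurable_fst measurableT).
transitivity (distribution P ZZ diag).
  rewrite /distribution /pushforward /=; congr (P _).
  by apply/seteqP; split => w /= /eqP.
rewrite -(product_measure_unique rect mdiag).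
(* The section of the diagonal over [y] is the single point [y], which the law of [X i] does not
   charge. *)
rewrite /product_measure1 integral0_eq//= => y _.
rewrite /distribution /pushforward /= -[RHS](noatom y); congr (P _).
by apply/seteqP; split => w; rewrite /= xsectionE /= => /eqP.
Qed.
End Probability.

(** * Almost sure properties of the channel *)

Section Channel.
Context (R : realType) (d : measure_display) (T : measurableType d).
Context (P : probability T R) (K M : nat).
Variables (mu : 'I_M -> R) (h : 'I_K -> T -> R) (g : 'I_K -> 'I_M -> T -> R).
Hypothesis mu_ge0 : forall m, 0 <= mu m.
Hypothesis mh : forall k, measurable_fun [set: T] (h k).
Hypothesis mg : forall k m, measurable_fun [set: T] (g k m).
Hypothesis h_ge0 : forall k w, 0 <= h k w.
Hypothesis g_ge0 : forall k m w, 0 <= g k m w.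
Hypothesis indep : ft_coords_independent P h g.
Hypothesis ccdf : continuous (ft_joint_cdf P h g).

Local Notation X := (fun i w => ft_chan_vec h g w 0 i).
Local Notation hi k := (lshift (K * M) k).
Local Notation gi k m := (rshift K (mxvec_index k m)).
Local Notation G k w := (ft_wgain mu (fun k m => g k m w) k).

Lemma chan_vec_h k : X (hi k) = h k.
Proof. by apply/funext => w; rewrite /ft_chan_vec row_mxEl mxE. Qed.

Lemma chan_vec_g k m : X (gi k m) = g k m.
Proof. by apply/funext => w; rewrite /ft_chan_vec row_mxEr mxvecE mxE. Qed.

Lemma measurable_chan_vec i : measurable_fun [set: T] (X i).
Proof.
have [k|j] := splitP i; move=> E.
  by rewrite (_ : i = hi k) ?chan_vec_h//; exact: val_inj.
case/mxvec_indexP: j E => k m E.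
by rewrite (_ : i = gi k m) ?chan_vec_g//; exact: val_inj.
Qed.

Lemma chan_vec_no_atom i c : P [set w | X i w = c] = 0%E.
Proof. exact: (continuous_cdf_no_atom measurable_chan_vec i c ccdf). Qed.

Lemma ae_chan_vec_neq0 i : {ae P, forall w, X i w != 0}.
Proof.
exists [set w | X i w = 0]; split; last by move=> w /negP; rewrite negbK => /eqP.
  rewrite (_ : [set _ | _] = X i @^-1` [set 0])// -[Y in measurable Y]setTI.
  exact: measurable_chan_vec.
exact: chan_vec_no_atom.
Qed.

Lemma ae_h_gt0 : {ae P, forall w, forall k, 0 < h k w}.
Proof.
apply: filter_forall => k; apply: filterS (ae_chan_vec_neq0 (hi k)) => w.
by rewrite (congr1 (@^~ w) (chan_vec_h k)) lt_def h_ge0 andbT.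
Qed.

Variable m0 : 'I_M.
Hypothesis mu_m0 : 0 < mu m0.

(** The single term [mu m0 * g k m0] is almost surely positive, and the others are nonnegative. *)
Lemma ae_wgain_gt0 : {ae P, forall w, forall k, 0 < G k w}.
Proof.
apply: filter_forall => k; apply: filterS (ae_chan_vec_neq0 (gi k m0)) => w.
rewrite (congr1 (@^~ w) (chan_vec_g k m0)) => g0.
rewrite /ft_wgain (bigD1 m0)//= ltr_pwDl//.
  by rewrite mulr_gt0// lt_def g0 g_ge0.
by apply: sumr_ge0 => m _; rewrite mulr_ge0.
Qed.

Let sigma k := g_sigma_algebraType (others X (hi k)).

Lemma measurable_others_h k l : l != k -> measurable_fun [set: sigma k] (h l).
Proof.
move=> lk; rewrite -(chan_vec_h l); apply: measurable_others.
by rewrite (inj_eq (@lshift_inj _ _)).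
Qed.

(** The case [l = k] is included: [sigma k] leaves out [h k] only and keeps every coordinate of
    [g]. *)
Lemma measurable_others_wgain k l : measurable_fun [set: sigma k] (fun w => G l w).
Proof.
apply: measurable_sum => m; apply: measurable_funM; first exact: measurable_cst.
rewrite -(chan_vec_g l m); apply: measurable_others.
by rewrite eq_sym eq_lrshift.
Qed.

Lemma ae_no_tie k l : k != l ->
  {ae P, forall w, h k w * G l w != h l w * G k w}.
Proof.
move=> kl.
(* For positive gains this is [h l * G k / G l], the value a tie imposes on [h k]. Writing the
   quotient through [ln] and [expR] reduces its measurability to sums and differences. *)
pose Y w := expR (ln (h l w) + ln (G k w) - ln (G l w)).
have mY : measurable_fun [set: sigma k] Y.
  apply: measurableT_comp; first exact: measurable_expR.
  apply: measurable_funB; last first.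
    apply: measurableT_comp; first exact: measurable_ln.
    exact: measurable_others_wgain.
  apply: measurable_funD; apply: measurableT_comp; try exact: measurable_ln.
    by apply: measurable_others_h; rewrite eq_sym.
  exact: measurable_others_wgain.
have PY := prob_eq_others measurable_chan_vec indep mY (chan_vec_no_atom (hi k)).
have aeY : {ae P, forall w, X (hi k) w != Y w}.
  exists [set w | X (hi k) w = Y w]; split => //; last first.
    by move=> w /negP; rewrite negbK => /eqP.
  have mY' := measurable_of_others measurable_chan_vec mY.
  rewrite -[Z in measurable Z]setTI (_ : [set _ | _] =
    (fun w => X (hi k) w == Y w) @^-1` [set true]); last first.
    by apply/seteqP; split => w /= /eqP.
  exact: (measurable_fun_eqr
    (measurable_chan_vec (hi k)) mY' measurableT).
apply: filterS (filterI (filterI ae_h_gt0 ae_wgain_gt0) aeY) => w [[h0 G0]].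
rewrite (congr1 (@^~ w) (chan_vec_h k)); apply: contra_neq => tie.
rewrite /Y -lnM ?posrE// -tie -ln_div ?posrE ?mulr_gt0//.
by rewrite lnK ?posrE ?divr_gt0 ?mulr_gt0// mulfK// gt_eqF.
Qed.
End Channel.

(** * From a fixed channel to almost every channel *)

Unset Implicit Arguments.

Theorem theorem3p3 (R : realType) (d : measure_display) (T : measurableType d)
  (P : probability T R) (K M : nat) (hK : (2 <= K)%N)
  (mu : 'I_M -> R) (Pst : 'I_K -> R)
  (h : 'I_K -> T -> R) (g : 'I_K -> 'I_M -> T -> R) :
  (forall m, 0 <= mu m) ->
  (forall k, 0 < Pst k) ->
  (forall k, measurable_fun [set: T] (h k)) ->
  (forall k m, measurable_fun [set: T] (g k m)) ->
  (forall k w, 0 <= h k w) ->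
  (forall k m w, 0 <= g k m w) ->
  ft_coords_independent P h g ->
  continuous (ft_joint_cdf P h g) ->
  (forall x, differentiable (ft_joint_cdf P h g) x) ->
  {ae P, forall w, forall pi : {perm 'I_K},
     let hw := fun k => h k w in
     let gw := fun k m => g k m w in
     ft_ratio_sorted mu hw gw pi ->
     let cond := ((1 + hw (pi (ft_ord_1st hK)) * Pst (pi (ft_ord_1st hK)))%:E
                  >= ft_ratio mu hw gw (pi (ft_ord_2nd hK)))%E in
     ((forall p, ft_optimal mu Pst hw gw p -> ft_at_most_one_pos p) <-> cond)
     /\ (cond -> forall p, ft_optimal mu Pst hw gw p ->
           (p (pi (ft_ord_1st hK)))%:E = ft_tdma_power mu Pst hw gw (pi (ft_ord_1st hK))
           /\ (forall k, k != pi (ft_ord_1st hK) -> p k = 0))}.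
Proof.
move=> mu0 P0 mh mg h0 g0 indep ccdf _.
have hpos := ae_h_gt0 mh mg h0 ccdf.
suff H : {ae P, forall w, (forall k, h k w > 0) /\
    let G := ft_wgain mu (fun k m => g k m w) in
    ((forall k, G k = 0) \/ (forall k, 0 < G k) /\
      (forall k l, k != l -> h k w * G l != h l w * G k))}.
  apply: filterS H => w [hw Gw] pi sorted.
  apply: dtdma_optimality => // k.
  by apply: sumr_ge0 => m _; rewrite mulr_ge0.
(* One positive multiplier makes all weighted gains almost surely positive and free of ties; if
   there is none, all weighted gains vanish. *)
have [[m mum]|allmu0] := pselect (exists m, 0 < mu m); last first.
  apply: filterS hpos => w hw; split=> //; left => k; apply: big1 => m _.
  have -> : mu m = 0; last by rewrite mul0r.
  apply/eqP; rewrite eq_le mu0 andbT leNgt; apply/negP => mum.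
  by apply: allmu0; exists m.
have Gpos := ae_wgain_gt0 mu0 mh mg g0 ccdf mum.
have noties : {ae P, forall w, forall k l, k != l ->
    h k w * ft_wgain mu (fun k m => g k m w) l !=
    h l w * ft_wgain mu (fun k m => g k m w) k}.
  apply: filter_forall => k; apply: filter_forall => l.
  have [->|kl] := eqVneq k l; first by apply: filterE.
  by apply: filterS (ae_no_tie mu0 mh mg h0 g0 indep ccdf mum kl) => w.
apply: filterS (filterI hpos (filterI Gpos noties)) => w [hw [Gw nt]].
by split=> //; right.
Qed.
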